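(* Let $f:\mathbb{R}^d\to\mathbb{R}$ be differentiable, $L$-smooth (i.e. $\|\nabla f(x)-\nabla f(y)\|\le L\|x-y\|$ for all $x,y\in\mathbb{R}^d$), and bounded from below by $f^*\in\mathbb{R}$. Suppose there exists $\mu>0$ such that $\|\nabla f(x)\|^2\ge2\mu(f(x)-f^* )$ for all $x\in\mathbb{R}^d$. Let $g$ be a gradient estimator for which there are constants $A,B,C,b,c\ge0$ such that for every $x\in\mathbb{R}^d$ $$\langle\nabla f(x),\mathbb{E}[g(x)]\rangle\ge b\|\nabla f(x)\|^2-c,\qquad \mathbb{E}[\|g(x)\|^2]\le 2A(f(x)-f^* )+B\|\nabla f(x)\|^2+C.$$ Choose a stepsize such that $$0<\gamma<\min\left\{\frac{\mu b}{L(A+\mu B)},\frac{1}{\mu b}\right\}.$$ Let $\delta^0=f(x^0)-f^*$. Then for every $T\ge1$ the iterates of BiasedSGD satisfy $$\mathbb{E}[f(x^T)-f^*]\le(1-\gamma\mu b)^T\delta^0+\frac{LC\gamma}{2\mu b}+\frac{c}{\mu b}.$$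
   Context: A gradient estimator is a (possibly random, possibly biased) mapping $g:\mathbb{R}^d\to\mathbb{R}^d$. BiasedSGD with starting point $x^0\in\mathbb{R}^d$ and stepsize $\gamma>0$ is the iteration $x^{t+1}=x^t-\gamma g^t$, $t=0,1,2,\dots$, where $g^t=g(x^t)$ is a fresh realization of the estimator at $x^t$ (conditionally on $x^t$, $g^t$ has the law of $g(x)$ at $x=x^t$). $\mathbb{E}$ is expectation over the randomness of the algorithm, and $\|\cdot\|$ is the Euclidean norm. *)

(* Defs.v *)
(* MathComp / MathComp-Analysis world. *)
From HB Require Import structures.
From mathcomp Require Import all_boot all_order all_algebra.
From mathcomp Require Import all_classical all_reals all_analysis.

Set Implicit Arguments.
Unset Strict Implicit.
Unset Printing Implicit Defensive.

Import Order.TTheory GRing.Theory Num.Theory.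
Import numFieldNormedType.Exports.

Local Open Scope classical_set_scope.
Local Open Scope ring_scope.

(* R^d with its Borel sigma-algebra; convertible to 'rV[R]_d, on which the
   library puts a topology but no measurable structure. *)
Notation borel_rV R d := (g_sigma_algebraType (@open 'rV[R]_d)).

Definition dot (R : realType) (d : nat) (u v : 'rV[R]_d) : R :=
  \sum_(i < d) u 0 i * v 0 i.

(* The library norm `|v| on 'rV[R]_d is the sup norm, hence a separate
   Euclidean norm. *)
Definition enorm (R : realType) (d : nat) (v : 'rV[R]_d) : R :=
  Num.sqrt (dot v v).

Definition gradient (R : realType) (d : nat) (f : 'rV[R]_d -> R)
    (x : 'rV[R]_d) : 'rV[R]_d :=
  \row_(i < d) 'D_(delta_mx 0 i) f x.

Definition L_smooth (R : realType) (d : nat) (f : 'rV[R]_d -> R) (L : R) :=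
  forall x y : 'rV[R]_d,
    enorm (gradient f x - gradient f y) <= L * enorm (x - y).

(* A gradient estimator is given by the law of its value g(x) at every point x,
   that is, by a probability kernel. *)
Definition estimator (R : realType) (d : nat) :=
  R.-pker (borel_rV R d) ~> (borel_rV R d).

(* The coordinatewise expectation of g(x). It is only meaningful when the
   coordinates are integrable, e.g. when E[||g(x)||^2] is finite. *)
Definition mean (R : realType) (d : nat) (g : estimator R d)
    (x : 'rV[R]_d) : 'rV[R]_d :=
  \row_(i < d) (\int[g x]_y (y : 'rV[R]_d) 0 i)%R.

Definition second_moment (R : realType) (d : nat) (g : estimator R d)
    (x : 'rV[R]_d) : \bar R :=
  (\int[g x]_y (enorm (y : 'rV[R]_d) ^+ 2)%:E)%E.

(* The last clause says that g(x), at x = X t, is a regular conditional law of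
   G t given X t. *)
Definition BiasedSGD (R : realType) (d : nat) (g : estimator R d)
    (x0 : 'rV[R]_d) (gamma : R)
    (disp : measure_display) (Omega : measurableType disp)
    (P : probability Omega R) (X G : nat -> Omega -> 'rV[R]_d) : Prop :=
  [/\ forall t, measurable_fun setT (X t : Omega -> borel_rV R d),
      forall t, measurable_fun setT (G t : Omega -> borel_rV R d),
      forall w, X 0%N w = x0,
      forall t w, X t.+1 w = X t w - gamma *: G t w
    & forall (t : nat) (U V : set (borel_rV R d)),
        measurable U -> measurable V ->
        P (X t @^-1` U `&` G t @^-1` V) =
          (\int[P]_(w in X t @^-1` U) g (X t w) V)%E].

(* Main.v *)
(* Smoothness gives f (x - gamma y) <= f x - gamma <grad f x, y>
   + (L gamma^2 / 2) |y|^2. Integrating in y against the law of g(x) and using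
   the two bounds on the estimator, then the PL inequality (the coefficient of
   |grad f x|^2 is nonpositive for the allowed stepsizes), yields for every x
     E[f (x - gamma g(x))] - fstar
       <= (1 - gamma mu b) (f x - fstar) + gamma c + L C gamma^2 / 2.
   The fixed point of the affine map on the right is L C gamma / (2 mu b)
   + c / (mu b), so it remains to integrate over the law of X t and iterate.
   Working with f - fstar >= 0 makes all outer integrals nonnegative, hence no
   integrability of f (X t) or of the gradient along the iterates is needed. *)
Require Import Defs.
From HB Require Import structures.
From mathcomp Require Import all_boot all_order all_algebra.
From mathcomp Require Import all_classical all_reals all_analysis.
From mathcomp Require Import measurable_realfun ring lra.
Import Order.TTheory GRing.Theory Num.Theory.
Import numFieldNormedType.Exports.
Local Open Scope classical_set_scope.
Local Open Scope ring_scope.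

(** * Euclidean inner product and norm *)

Section euclidean.
Context {R : realType} {d : nat}.
Implicit Types (u v w : 'rV[R]_d) (a : R).

Lemma dotC u v : dot u v = dot v u.
Proof. by apply: eq_bigr => i _; rewrite mulrC. Qed.

Lemma dotDl u v w : dot (u + v) w = dot u w + dot v w.
Proof. by rewrite -big_split; apply: eq_bigr => i _; rewrite mxE mulrDl. Qed.

Lemma dotZl a u v : dot (a *: u) v = a * dot u v.
Proof. by rewrite mulr_sumr; apply: eq_bigr => i _; rewrite mxE mulrA. Qed.

Lemma dotBl u v w : dot (u - v) w = dot u w - dot v w.
Proof. by rewrite dotDl -scaleN1r dotZl mulN1r. Qed.

Lemma dotZr a u v : dot u (a *: v) = a * dot u v.
Proof. by rewrite dotC dotZl dotC. Qed.

Lemma dotBr u v w : dot w (u - v) = dot w u - dot w v.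
Proof. by rewrite dotC dotBl !(dotC w). Qed.

Lemma dot_ge0 u : 0 <= dot u u.
Proof. by apply: sumr_ge0 => i _; rewrite -expr2 sqr_ge0. Qed.

Lemma dot_eq0 u : dot u u = 0 -> u = 0.
Proof.
move/eqP; rewrite psumr_eq0 => [/allP u0|i _]; last by rewrite -expr2 sqr_ge0.
apply/rowP => i; rewrite mxE; apply/eqP.
by have := u0 i (mem_index_enum i); rewrite mulf_eq0 orbb.
Qed.

Lemma enorm_ge0 u : 0 <= enorm u.
Proof. exact: sqrtr_ge0. Qed.

Lemma sqr_enorm u : enorm u ^+ 2 = dot u u.
Proof. exact/sqr_sqrtr/dot_ge0. Qed.

Lemma enormZ a u : enorm (a *: u) = `|a| * enorm u.
Proof.
by rewrite /enorm dotZl dotZr mulrA -expr2 sqrtrM ?sqr_ge0// sqrtr_sqr.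
Qed.

(** Cauchy-Schwarz: the squared norm of [dot v v *: u - dot u v *: v] is nonnegative and has the
    factor [dot v v], which is divided out when positive. *)
Lemma le_dot_enorm u v : dot u v <= enorm u * enorm v.
Proof.
rewrite /enorm -sqrtrM ?dot_ge0//; apply/ler_normlW; rewrite -sqrtr_sqr.
apply: ler_wsqrtr.
have [v0|v_neq0] := eqVneq (dot v v) 0.
  rewrite v0 mulr0 (dot_eq0 _ v0) -(scale0r (0 : 'rV[R]_d)) dotZr mul0r.
  by rewrite expr0n.
have v_gt0 : 0 < dot v v by rewrite lt0r v_neq0 dot_ge0.
have := dot_ge0 (dot v v *: u - dot u v *: v).
rewrite dotBl !dotBr !(dotZl, dotZr) (dotC v u) => h.
by rewrite -subr_ge0 -(pmulr_rge0 _ v_gt0); apply: le_trans h _; lra.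
Qed.

(** A crude domination, from |t| <= 1 + t^2: it makes coordinates integrable as soon as the second
    moment is finite. *)
Lemma normr_coord_le u i : `|u 0 i| <= 1 + enorm u ^+ 2.
Proof.
have : u 0 i ^+ 2 <= enorm u ^+ 2.
  rewrite sqr_enorm /dot (bigD1 i)//= -expr2 lerDl.
  by apply: sumr_ge0 => j _; rewrite -expr2 sqr_ge0.
by rewrite ler_norml; nra.
Qed.

End euclidean.

(** * Gradients and the descent inequality *)

Section descent.
Context {R : realType} {d : nat} (f : 'rV[R]_d -> R).
Hypothesis f_diff : forall x, differentiable f x.

Lemma derive_gradient x v : 'D_v f x = dot (gradient f x) v.
Proof.
rewrite deriveE//.
have -> : 'd f x v = \sum_i v 0 i * 'd f x (delta_mx 0 i).
  rewrite {1}(row_sum_delta v) linear_sum; apply: eq_bigr => i _.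
  by rewrite linearZ.
by apply: eq_bigr => i _; rewrite mxE deriveE// mulrC.
Qed.

Lemma is_derive_line (x v : 'rV[R]_d) (s : R) :
  is_derive s 1 (fun s => f (x + s *: v)) (dot (gradient f (x + s *: v)) v).
Proof.
rewrite -derive_gradient.
have : derivable f (x + s *: v) v by exact: diff_derivable.
have E : (fun h : R => h^-1 *: (f (h *: v + (x + s *: v)) - f (x + s *: v))) =
    (fun h : R => h^-1 *: ((fun s => f (x + s *: v)) (h *: 1 + s)
                         - (fun s => f (x + s *: v)) s)).
  apply/funext => h /=; congr (_ *: (f _ - _)).
  by rewrite [h *: 1]mulr1 scalerDl addrCA.
by rewrite /derivable /derive E => ?; split.
Qed.

(** The mean value theorem on [0, 1] replaces integration of the gradient: [psi] is f along the
    segment minus the linear and quadratic terms, and the claim is psi 1 <= psi 0. *)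
Lemma descent (L : R) (f_smooth : L_smooth f L) (x v : 'rV[R]_d) :
  f (x + v) <= f x + dot (gradient f x) v + L / 2 * enorm v ^+ 2.
Proof.
pose psi s := f (x + s *: v) - s * dot (gradient f x) v
              - L / 2 * enorm v ^+ 2 * s ^+ 2.
pose dpsi s := dot (gradient f (x + s *: v)) v - dot (gradient f x) v
              - L * enorm v ^+ 2 * s.
have psiP (s : R) : is_derive s 1 psi (dpsi s).
  have h := is_derive_line x v s.
  rewrite /psi; apply: is_derive_eq.
  rewrite /dpsi /GRing.scale/=; lra.
have psi_cont : continuous psi.
  move=> s; apply/differentiable_continuous/derivable1_diffP.
  exact: ex_derive.
have [s s01] := @MVT R psi dpsi 0 1 ltr01 (fun s _ => psiP s)
  (continuous_subspaceT psi_cont).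
rewrite subr0 mulr1 /psi scale0r scale1r addr0 => psi10.
(* By Cauchy-Schwarz and smoothness, the gradient increment paired with v is at most L * s * |v|^2,
   for s > 0. *)
suff : dpsi s <= 0 by lra.
move: s01; rewrite in_itv/= => /andP[s0 _].
have := le_dot_enorm (gradient f (x + s *: v) - gradient f x) v.
have := f_smooth (x + s *: v) x.
rewrite addrAC subrr add0r enormZ (gtr0_norm s0) dotBl /dpsi.
have := enorm_ge0 v; nra.
Qed.

End descent.

(** * Borel measurability in R^d *)

Section borel.
Context {R : realType} {d : nat}.

Lemma measurable_continuous (f : 'rV[R]_d -> R) :
  continuous f -> measurable_fun setT (f : borel_rV R d -> R).
Proof.
move=> /continuousP cf; apply: (measurability _ (RGenOpens.measurableE R)).
move=> _ [_ [a [b ->]] <-]; rewrite setTI.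
by apply: sub_sigma_algebra; apply: cf; exact: interval_open.
Qed.

Lemma measurable_coord (i : 'I_d) :
  measurable_fun setT (fun x : borel_rV R d => (x : 'rV[R]_d) 0 i).
Proof. by apply: measurable_continuous; exact: coord_continuous. Qed.

Lemma measurable_preimage_ball disp (T : measurableType disp)
    (F : T -> 'rV[R]_d) (x : 'rV[R]_d) (e : R) :
  (forall i, measurable_fun setT (fun w => F w 0 i)) ->
  measurable (F @^-1` ball x e).
Proof.
(* A nonpositive radius is treated apart: the ball is then empty, whereas for d = 0 the intersection
   over coordinates is the whole space. *)
move=> mF; have [e0|e0] := ltP 0 e; last first.
  rewrite (_ : _ @^-1` _ = set0)//; apply/seteqP; split => // w [e_gt0 _].
  by have := lt_le_trans e_gt0 e0; rewrite ltxx.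
rewrite (_ : _ @^-1` _ =
  \bigcap_(i in [set: 'I_d]) ((fun w => F w 0 i) @^-1` ball (x 0 i) e)).
  apply: fin_bigcap_measurable => // i _.
  rewrite -[X in measurable X]setTI; apply: mF => //.
  exact: measurable_ball.
apply/seteqP; split => [w [_ h] i _|w h]; first exact: h.
by split => // i j; rewrite ord1; exact: h.
Qed.

(* R^d is second countable: an open set is the union of the balls it contains
   with rational centre and radius of the form 1 / n.+1. *)
Lemma measurable_fun_rV disp (T : measurableType disp) (F : T -> 'rV[R]_d) :
  (forall i, measurable_fun setT (fun w => F w 0 i)) ->
  measurable_fun setT (F : T -> borel_rV R d).
Proof.
move=> mF.
apply: (@measurability _ _ T (borel_rV R d) setT F (@open 'rV[R]_d)) => //.
move=> _ [U openU <-]; rewrite setTI.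
pose c (q : 'rV[rat]_d * nat) := ball (map_mx ratr q.1 : 'rV[R]_d) q.2.+1%:R^-1.
rewrite (_ : F @^-1` U =
  \bigcup_(q in [set: 'rV[rat]_d * nat])
     (if `[< c q `<=` U >] then F @^-1` c q else set0)).
  apply: countable_bigcupT_measurable => [|q]; first exact: countableP.
  case: ifP => // _; exact: measurable_preimage_ball.
apply/seteqP; split => [w /= Uw|w [q _]]; last first.
  by case: ifPn => // /asboolP; apply.
have /nbhs_ballP[e /= e0 eU] := open_nbhs_nbhs (conj openU Uw).
(* Every point of the rational ball lies within twice its radius of [F w], hence the bound e / 2. *)
have [n ne] : exists n, n.+1%:R^-1 < e / 2.
  have e2 : 0 < e / 2 by lra.
  by have /filter_ex := near_infty_natSinv_lt (PosNum e2); exact.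
have n0 : 0 < n.+1%:R^-1 :> R by rewrite invr_gt0.
have hq i : exists q : rat, ball (F w 0 i) n.+1%:R^-1 (ratr q).
  have [r [br [q _ rE]]] := @dense_rat R (ball (F w 0 i) n.+1%:R^-1)
    (ex_intro _ _ (ballxx _ n0)) (ball_open _ _).
  by exists q; rewrite rE.
exists (\row_i xchoose (hq i), n) => //.
have qw : c (\row_i xchoose (hq i), n) (F w).
  split => // i j; rewrite !mxE ord1; exact/ball_sym/(xchooseP (hq j)).
case: asboolP => // -[] y; move/ball_sym: qw => qw qy.
apply/eU/(@le_ball _ _ _ (n.+1%:R^-1 + n.+1%:R^-1)); last first.
  exact: ball_triangle qy.
by rewrite (splitr e) lerD// ltW.
Qed.

End borel.

(** * The graph kernel of k along X *)

Section kgraph.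
Local Open Scope ereal_scope.
Context {d d1 d2} {Omega : measurableType d} {E : measurableType d1}
  {F : measurableType d2} {R : realType} (k : R.-pker E ~> F) (X : Omega -> E).

(* The law of (X w, y) for y drawn from k (X w). The dummy unit argument gives
   the source the product shape expected by the composition of kernels. *)
Definition kgraph (uw : unit * Omega) (A : set (E * F)) : \bar R :=
  k (X uw.2) (xsection A (X uw.2)).

Let kgraph0 uw : kgraph uw set0 = 0.
Proof. by rewrite /kgraph xsection0 measure0. Qed.

Let kgraph_ge0 uw A : 0 <= kgraph uw A.
Proof. exact: measure_ge0. Qed.

Let kgraph_sigma_additive uw : semi_sigma_additive (kgraph uw).
Proof.
move=> A mA tA mUA; rewrite /kgraph xsection_bigcup.
apply: measure_semi_sigma_additive => [n||]; first exact: measurable_xsection.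
- exact: trivIset_xsection.
- by apply: bigcupT_measurable => n; exact: measurable_xsection.
Qed.

HB.instance Definition _ uw := isMeasure.Build _ _ _
  (kgraph uw) (kgraph0 uw) (kgraph_ge0 uw) (@kgraph_sigma_additive uw).

Definition mkgraph (mX : measurable_fun setT X) (uw : unit * Omega) :
  {measure set (E * F) -> \bar R} := kgraph uw.

Hypothesis mX : measurable_fun setT X.

Let measurable_mkgraph A : measurable A ->
  measurable_fun setT (mkgraph mX ^~ A).
Proof.
move=> mA; apply: (@measurableT_comp _ _ _ _ _ _
  (fun x => k x (xsection A x)) _ (X \o snd)).
  by apply: measurable_fun_xsection_finite_kernel; rewrite inE.
exact: measurableT_comp.
Qed.

HB.instance Definition _ :=
  @isKernel.Build _ _ _ _ R (mkgraph mX) measurable_mkgraph.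

Let prob_mkgraph uw : mkgraph mX uw setT = 1.
Proof. by rewrite /mkgraph /= /kgraph xsectionE preimage_setT prob_kernel. Qed.

HB.instance Definition _ :=
  @Kernel_isProbability.Build _ _ _ _ R (mkgraph mX) prob_mkgraph.

End kgraph.

(** * Disintegration of the joint law of X and Y *)

Section disintegration.
Local Open Scope ereal_scope.
Context {d d1 d2} {Omega : measurableType d} {E : measurableType d1}
  {F : measurableType d2} {R : realType} (P : probability Omega R)
  (k : R.-pker E ~> F) (X : Omega -> E) (Y : Omega -> F).
Hypotheses (mX : measurable_fun setT X) (mY : measurable_fun setT Y).
Hypothesis XYk : forall U V, measurable U -> measurable V ->
  P (X @^-1` U `&` Y @^-1` V) = \int[P]_(w in X @^-1` U) k (X w) V.

Let mXY : measurable_fun setT (fun w => (X w, Y w)).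
Proof. exact: measurable_fun_pair. Qed.

Let XY : {mfun Omega >-> (E * F)%type} :=
  HB.pack (fun w => (X w, Y w)) (isMeasurableFun.Build _ _ _ _ _ mXY).

Let kP : R.-pker unit ~> Omega :=
  kprobability (measurable_cst (P : pprobability Omega R)).

(** Two finite measures that agree on measurable rectangles, a pi-system generating the product
    sigma-algebra, are equal. On a rectangle U x V the section of the graph is V or empty according
    to whether X w lies in U, which is the hypothesis [XYk]. *)
Lemma joint_law_kcomp (A : set (E * F)) : measurable A ->
  distribution P XY A = kcomp kP (mkgraph k X mX) tt A.
Proof.
pose rect : set (set (E * F)) :=
  [set A `*` B | A in measurable & B in measurable].
apply: (measure_unique rect (fun=> setT)).
- by rewrite measurable_prod_measurableType.
- move=> _ _ [A1 mA1 [B1 mB1 <-]] [A2 mA2 [B2 mB2 <-]].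
  exists (A1 `&` A2); first exact: measurableI.
  by exists (B1 `&` B2); [exact: measurableI|rewrite setXI].
- by move=> _; exists setT => //; exists setT => //; rewrite setXTT.
- by rewrite bigcup_const.
- move=> _ [U mU [V mV <-]].
  have mXU : measurable (X @^-1` U).
    by rewrite -[X in measurable X]setTI; exact: mX.
  transitivity (P (X @^-1` U `&` Y @^-1` V)); first by [].
  rewrite XYk// /kcomp/= integral_mkcond.
  apply: eq_integral => w _; rewrite /mkgraph/= /kgraph/= patchE.
  have [|/negP] := boolP (w \in _).
    by rewrite inE => Uw; rewrite in_xsectionX ?inE.
  by rewrite inE => Uw; rewrite notin_xsectionX ?measure0// notin_setE.
- by move=> _; rewrite (@le_lt_trans _ _ 1) ?ltry//; exact: probability_le1.
Qed.

(** The tower property: pass to the joint law, write it as a composition of kernels, and integrate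
    out y first; the inner measure is the image of [k (X w)] under y |-> (X w, y). *)
Lemma integral_disintegration (h : E * F -> \bar R) :
  (forall z, 0 <= h z) -> measurable_fun setT h ->
  \int[P]_w h (X w, Y w) = \int[P]_w \int[k (X w)]_y h (X w, y).
Proof.
move=> h0 mh.
transitivity (\int[distribution P XY]_z h z).
  by rewrite ge0_integral_distribution.
rewrite (eq_measure_integral (kcomp kP (mkgraph k X mX) tt)); last first.
  by move=> A mA _; exact: joint_law_kcomp.
rewrite integral_kcomp//; apply: eq_integral => w _.
have mpair : measurable_fun setT (pair (X w) : F -> E * F).
  exact: pair1_measurable.
transitivity (\int[pushforward (k (X w)) (pair (X w))]_z h z).
  apply: eq_measure_integral => A mA _.
  by rewrite /mkgraph/= /kgraph/= xsectionE.
by rewrite ge0_integral_pushforward.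
Qed.

End disintegration.

(** * First and second moments of a law on R^d *)

Section moments.
Context {R : realType} {d : nat}
  (m : {measure set (borel_rV R d) -> \bar R}).

Lemma measurable_sqr_enorm :
  measurable_fun setT (fun y : borel_rV R d => enorm (y : 'rV[R]_d) ^+ 2).
Proof.
under eq_fun do rewrite sqr_enorm.
by apply: measurable_sum => i; apply: measurable_funM; exact: measurable_coord.
Qed.

Hypothesis m1 : m setT = 1%E.

Let integrable_cst (s : R) : m.-integrable setT (EFin \o cst s).
Proof.
apply/integrableP; split; first exact/measurable_EFinP.
by rewrite (integral_cst m measurableT `|s|%:E) m1 mule1 ltry.
Qed.

Hypothesis m2_fin : (\int[m]_y (enorm (y : 'rV[R]_d) ^+ 2)%:E < +oo)%E.

Lemma integrable_sqr_enorm :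
  m.-integrable setT
    (EFin \o (fun y : borel_rV R d => enorm (y : 'rV[R]_d) ^+ 2)).
Proof.
apply/integrableP; split; last first.
  by under eq_integral do rewrite /= ger0_norm ?sqr_ge0//.
by apply/measurable_EFinP; exact: measurable_sqr_enorm.
Qed.

Lemma integrable_coord (i : 'I_d) :
  m.-integrable setT (EFin \o (fun y : borel_rV R d => (y : 'rV[R]_d) 0 i)).
Proof.
apply: (@le_integrable _ _ _ _ _ measurableT _
  (EFin \o (fun y : borel_rV R d => 1 + enorm (y : 'rV[R]_d) ^+ 2))).
- by apply/measurable_EFinP; exact: measurable_coord.
- move=> y _; rewrite /= lee_fin (le_trans (normr_coord_le y i))//.
  exact: ler_norm.
- exact: (integrableD measurableT (integrable_cst 1) integrable_sqr_enorm).
Qed.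

Lemma integrable_dot (a : 'rV[R]_d) :
  m.-integrable setT (EFin \o (fun y : borel_rV R d => dot a y)).
Proof.
rewrite (_ : _ \o _ =
  fun y : borel_rV R d => (\sum_i (a 0 i)%:E * ((y : 'rV[R]_d) 0 i)%:E)%E).
  by apply: integrable_sum => // i _; exact/integrableZl/integrable_coord.
by apply/funext => y /=; rewrite -sumEFin.
Qed.

Lemma integral_dot (a : 'rV[R]_d) :
  (\int[m]_y (dot a (y : 'rV[R]_d))%:E =
   (dot a (\row_i (\int[m]_y (y : 'rV[R]_d) 0 i)%R))%:E)%E.
Proof.
under eq_integral do rewrite -sumEFin; rewrite integral_sum// => [|i].
  rewrite -sumEFin; apply: eq_bigr => i _.
  under eq_integral do rewrite EFinM.
  rewrite integralZl ?mxE//; last exact: integrable_coord.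
  rewrite EFinM fineK//; apply: integrable_fin_num => //.
  exact: integrable_coord.
under eq_fun do rewrite EFinM.
exact/integrableZl/integrable_coord.
Qed.

(** The integrand has the shape of the descent upper bound as a function of the estimator's value
    y. *)
Lemma integral_quadratic (a : 'rV[R]_d) (s t : R) :
  (\int[m]_y (s + dot a (y : 'rV[R]_d) + t * enorm (y : 'rV[R]_d) ^+ 2)%:E =
   s%:E + (dot a (\row_i (\int[m]_y (y : 'rV[R]_d) 0 i)%R))%:E
   + t%:E * \int[m]_y (enorm (y : 'rV[R]_d) ^+ 2)%:E)%E.
Proof.
under eq_integral do rewrite 2!EFinD EFinM.
have s_int := integrable_cst s.
rewrite integralD//.
- rewrite integralD//; last exact: integrable_dot.
  rewrite integral_cst//= m1 mule1 integral_dot.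
  by rewrite integralZl//; exact: integrable_sqr_enorm.
- by apply: integrableD => //; exact: integrable_dot.
- by apply: integrableZl => //; exact: integrable_sqr_enorm.
Qed.

End moments.

(** * Stepsize conditions and the one-step inequality in real numbers *)

Lemma stepsize_bounds {R : realType} {L A B b mu gamma : R} :
  0 <= L -> 0 <= A -> 0 <= B -> 0 <= b -> 0 < mu -> 0 < gamma ->
  (gamma%:E < Order.min ((mu * b)%:E / (L * (A + mu * B))%:E)
                        (1 / (mu * b)%:E))%E ->
  [/\ 0 < b, gamma * mu * b < 1 & gamma * (L * (A + mu * B)) <= mu * b].
Proof.
move=> L0 A0 B0 b0 mu0 gamma0; rewrite lt_min => /andP[h1 h2].
(* If b were 0, the first quotient would be 0, even with a zero denominator, contradicting gamma >
   0. *)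
have b_gt0 : 0 < b.
  rewrite lt0r b0 andbT; apply/eqP => b_eq0; move: h1.
  by rewrite b_eq0 mulr0 mul0e lte_fin ltNge ltW.
have mub : 0 < mu * b by rewrite mulr_gt0.
split=> //.
  move: h2; rewrite inver gt_eqF// mul1e lte_fin -mulrA.
  by rewrite -[_^-1]mul1r ltr_pdivlMr.
have D0 : 0 <= L * (A + mu * B) by rewrite mulr_ge0// addr_ge0// mulr_ge0// ltW.
(* With a zero denominator the first quotient is +oo, but the product form of the bound is then
   trivial. *)
have [->|D_neq0] := eqVneq (L * (A + mu * B)) 0; first by rewrite mulr0 ltW.
have D_gt0 : 0 < L * (A + mu * B) by rewrite lt0r D_neq0.
by move: h1; rewrite inver gt_eqF// -EFinM lte_fin ltr_pdivlMr// => /ltW.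
Qed.

(** Here D is the gap f x - fstar, N the squared gradient norm, M the second moment and p the
    pairing of the gradient with the mean. Inserting the bounds on M and p leaves N with coefficient
    -gamma (b - L gamma B / 2) <= 0, so N may be replaced by 2 mu D. The D coefficient becomes 1 -
    gamma mu b - gamma (mu b - gamma L (A + mu B)), whose last term is dropped. *)
Lemma PL_step_bound {R : realFieldType} {L A B C b c mu gamma D N M p : R} :
  0 <= L -> 0 <= b -> 0 < mu -> 0 <= A -> 0 < gamma ->
  gamma * (L * (A + mu * B)) <= mu * b ->
  M <= 2 * A * D + B * N + C -> b * N - c <= p -> 2 * mu * D <= N -> 0 <= D ->
  D + - gamma * p + L * gamma ^+ 2 / 2 * M <=
  (1 - gamma * mu * b) * D + (gamma * c + L * C * gamma ^+ 2 / 2).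
Proof.
move=> L0 b0 mu0 A0 gamma0 gamma_le M_le p_ge N_ge D0.
have LBb : L * gamma * B <= b.
  rewrite -(ler_pM2l mu0); apply: le_trans gamma_le.
  have : 0 <= gamma * L * A by rewrite !mulr_ge0// ltW.
  lra.
have h1 : L * gamma ^+ 2 / 2 * M <=
    L * gamma ^+ 2 / 2 * (2 * A * D + B * N + C).
  by apply: ler_wpM2l => //; rewrite divr_ge0// mulr_ge0// sqr_ge0.
have h2 : gamma * (b * N - c) <= gamma * p by rewrite ler_pM2l.
have Nb : 0 <= gamma * ((b - L * gamma * B / 2) * (N - 2 * mu * D)).
  rewrite mulr_ge0 ?(ltW gamma0)// mulr_ge0// ?subr_ge0//; nra.
have Db : 0 <= gamma * (D * (mu * b - gamma * (L * (A + mu * B)))).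
  by rewrite mulr_ge0 ?(ltW gamma0)// mulr_ge0// subr_ge0.
lra.
Qed.

(** * One step of the iteration, pointwise and in expectation *)

Section step.
Context {R : realType} {d : nat} {f : 'rV[R]_d -> R} {L fstar mu : R}
  {g : estimator R d} {A B C b c gamma : R}.
Hypotheses (f_diff : forall x, differentiable f x)
  (L_ge0 : 0 <= L) (f_smooth : L_smooth f L) (f_lb : forall x, fstar <= f x)
  (f_PL : forall x, 2 * mu * (f x - fstar) <= enorm (gradient f x) ^+ 2)
  (g_mean : forall x,
     b * enorm (gradient f x) ^+ 2 - c <= dot (gradient f x) (mean g x))
  (g_second : forall x,
     (second_moment g x <=
      (2 * A * (f x - fstar) + B * enorm (gradient f x) ^+ 2 + C)%:E)%E)
  (A_ge0 : 0 <= A) (C_ge0 : 0 <= C) (b_ge0 : 0 <= b) (c_ge0 : 0 <= c)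
  (mu_gt0 : 0 < mu) (gamma_gt0 : 0 < gamma)
  (gamma_le : gamma * (L * (A + mu * B)) <= mu * b).

Local Notation r := (gamma * c + L * C * gamma ^+ 2 / 2).

Lemma differentiable_continuousT : continuous f.
Proof. by move=> x; exact/differentiable_continuous. Qed.

(** The pair carries the product of the two Borel sigma-algebras, so subtraction is shown measurable
    coordinate by coordinate before composing with the continuous f. *)
Lemma measurable_step : measurable_fun setT
  (fun z : borel_rV R d * borel_rV R d =>
     (f ((z.1 : 'rV[R]_d) - gamma *: (z.2 : 'rV[R]_d)) - fstar)%:E).
Proof.
apply/measurable_EFinP/measurable_funB => //.
apply: (@measurableT_comp _ _ _ _ _ _ (f : borel_rV R d -> R)).
  by apply: measurable_continuous; exact: differentiable_continuousT.
apply: measurable_fun_rV => i; under eq_fun do rewrite !mxE.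
apply: measurable_funB.
  exact: (measurableT_comp (measurable_coord i) measurable_fst).
apply: measurable_funM => //.
exact: (measurableT_comp (measurable_coord i) measurable_snd).
Qed.

Lemma expected_step (x : 'rV[R]_d) :
  (\int[g x]_y (f (x - gamma *: (y : 'rV[R]_d)) - fstar)%:E <=
   ((1 - gamma * mu * b) * (f x - fstar) + r)%:E)%E.
Proof.
(* Finiteness makes the coordinates integrable, so [mean g x] is a genuine expectation and the
   quadratic bound integrates term by term. *)
have m2_fin : (second_moment g x < +oo)%E.
  exact: le_lt_trans (g_second x) (ltry _).
pose G := gradient f x.
have le_f (y : 'rV[R]_d) : f (x - gamma *: y) - fstar <=
    f x - fstar + dot (- gamma *: G) y + (L * gamma ^+ 2 / 2) * enorm y ^+ 2.
  have := descent f f_diff L f_smooth x (- gamma *: y).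
  rewrite enormZ normrN (gtr0_norm gamma_gt0) dotZr dotZl scaleNr -/G.
  by rewrite exprMn; lra.
apply: (@le_trans _ _
    (\int[g x]_y (f x - fstar + dot (- gamma *: G) (y : 'rV[R]_d)
    + (L * gamma ^+ 2 / 2) * enorm (y : 'rV[R]_d) ^+ 2)%:E)%E).
  apply: ge0_le_integral => //.
  - by move=> y _; rewrite lee_fin subr_ge0.
  - exact: (measurableT_comp measurable_step
      (pair1_measurable (x : borel_rV R d))).
  - apply/measurable_EFinP/measurable_funD; last first.
      by apply: measurable_funM => //; exact: measurable_sqr_enorm.
    apply: measurable_funD => //; apply: measurable_sum => i.
    by apply: measurable_funM => //; exact: measurable_coord.
  - by move=> y _; rewrite lee_fin.
rewrite (integral_quadratic _ (@prob_kernel _ _ _ _ _ g x) m2_fin).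
have -> : \row_i (\int[g x]_y (y : 'rV[R]_d) 0 i)%R = mean g x by [].
have [M ME] : exists M : R, second_moment g x = M%:E.
  have ? : (0 <= second_moment g x)%E.
    by apply: integral_ge0 => y _; rewrite lee_fin sqr_ge0.
  exists (fine (second_moment g x)).
  by rewrite fineK// ge0_fin_numE.
rewrite [X in (_ * X)%E]ME -EFinM -!EFinD lee_fin dotZl.
have := g_second x; rewrite ME lee_fin => M_le.
by apply: PL_step_bound M_le (g_mean x) (f_PL x) _ => //; rewrite subr_ge0.
Qed.

(** Disintegration turns the expectation at t + 1 into an average over [X t] of the integrals
    bounded by [expected_step]. The factor 1 - gamma mu b must be nonnegative for the bound D to
    pass through it. *)
Lemma expectation_step {disp} {Omega : measurableType disp}
    {P : probability Omega R} {x0 : 'rV[R]_d} {X G : nat -> Omega -> 'rV[R]_d}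
    (sgd : BiasedSGD g x0 gamma P X G) (t : nat) (D : R) :
  gamma * mu * b <= 1 ->
  (\int[P]_w (f (X t w) - fstar)%:E <= D%:E)%E ->
  (\int[P]_w (f (X t.+1 w) - fstar)%:E <= ((1 - gamma * mu * b) * D + r)%:E)%E.
Proof.
move=> q1 IH; case: sgd => mX mG X0 XS XG.
have f_ge x : 0 <= f x - fstar by rewrite subr_ge0.
have mfX : measurable_fun setT (fun w => (f (X t w) - fstar)%:E).
  apply/measurable_EFinP/measurable_funB => //.
  apply: (@measurableT_comp _ _ _ _ _ _ (f : borel_rV R d -> R)) (mX t).
  by apply: measurable_continuous; exact: differentiable_continuousT.
under eq_integral do rewrite XS.
rewrite (integral_disintegration P g (X t) (G t) (mX t) (mG t) (XG t)
  (fun z => (f ((z.1 : 'rV[R]_d) - gamma *: (z.2 : 'rV[R]_d)) - fstar)%:E));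
  [|by move=> z; rewrite lee_fin|exact: measurable_step].
apply: (@le_trans _ _
    (\int[P]_w ((1 - gamma * mu * b)%:E * (f (X t w) - fstar)%:E + r%:E))%E).
  apply: ge0_le_integral => //.
  - by move=> w _; apply: integral_ge0 => y _; rewrite lee_fin.
  - apply: (@measurableT_comp _ _ _ _ _ _ (fun x : borel_rV R d =>
      \int[g x]_y (f ((x : 'rV[R]_d) - gamma *: (y : 'rV[R]_d)) - fstar)%:E)%E);
      last exact: mX.
    apply: (measurable_fun_integral_finite_kernel
      (fun z : borel_rV R d * borel_rV R d =>
        (f ((z.1 : 'rV[R]_d) - gamma *: (z.2 : 'rV[R]_d)) - fstar)%:E) g).
      by move=> z; rewrite lee_fin.
    exact: measurable_step.
  - by apply: emeasurable_funD => //; exact: measurable_funeM.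
  - by move=> w _; rewrite -EFinM -EFinD; exact: expected_step.
rewrite ge0_integralD//; last 3 first.
- by move=> w _; rewrite -EFinM lee_fin mulr_ge0// subr_ge0.
- exact: measurable_funeM.
- move=> w _; rewrite lee_fin addr_ge0 ?mulr_ge0 ?divr_ge0 ?exprn_ge0//;
    exact: ltW.
rewrite ge0_integralZl//; last 2 first.
- by move=> w _; rewrite lee_fin.
- by rewrite lee_fin subr_ge0.
rewrite integral_cst//= probability_setT mule1 [leRHS]EFinD EFinM.
by rewrite leeD2r// lee_wpmul2l// lee_fin subr_ge0.
Qed.

End step.

(* In the stepsize condition the quotients are taken in \bar R, where
   0^-1 = +oo and 0 * +oo = 0. *)
Theorem theorem4 (R : realType) (d : nat)
    (f : 'rV[R]_d -> R) (L fstar mu : R)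
    (f_diff : forall x, differentiable f x)
    (L_ge0 : 0 <= L) (f_smooth : L_smooth f L)
    (f_lb : forall x, fstar <= f x)
    (mu_gt0 : 0 < mu)
    (f_PL : forall x, enorm (gradient f x) ^+ 2 >= 2 * mu * (f x - fstar))
    (g : estimator R d) (A B C b c : R)
    (A_ge0 : 0 <= A) (B_ge0 : 0 <= B) (C_ge0 : 0 <= C)
    (b_ge0 : 0 <= b) (c_ge0 : 0 <= c)
    (g_mean : forall x,
       dot (gradient f x) (mean g x) >= b * enorm (gradient f x) ^+ 2 - c)
    (g_second : forall x,
       (second_moment g x <=
        (2 * A * (f x - fstar) + B * enorm (gradient f x) ^+ 2 + C)%:E)%E)
    (gamma : R) (gamma_gt0 : 0 < gamma)
    (gamma_lt : (gamma%:E < Order.min ((mu * b)%:E / (L * (A + mu * B))%:E)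
                                      (1 / (mu * b)%:E))%E)
    (x0 : 'rV[R]_d)
    (disp : measure_display) (Omega : measurableType disp)
    (P : probability Omega R) (X G : nat -> Omega -> 'rV[R]_d)
    (sgd : BiasedSGD g x0 gamma P X G)
    (T : nat) (T_ge1 : (1 <= T)%N) :
  ('E_P[fun w => (f (X T w) - fstar)%R] <=
   ((1 - gamma * mu * b) ^+ T * (f x0 - fstar)
    + L * C * gamma / (2 * mu * b) + c / (mu * b))%:E)%E.
Proof.
have [b_gt0 q_lt1 gamma_le] :=
  stepsize_bounds L_ge0 A_ge0 B_ge0 b_ge0 mu_gt0 gamma_gt0 gamma_lt.
have q_le1 := ltW q_lt1.
pose K := L * C * gamma / (2 * mu * b) + c / (mu * b).
have K_ge0 : 0 <= K.
  by rewrite addr_ge0// divr_ge0 ?mulr_ge0// ltW.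
(* The fixed-point equation of the affine recursion: the added constant is exactly what contraction
   removes from K. *)
have qK : gamma * mu * b * K = gamma * c + L * C * gamma ^+ 2 / 2.
  by rewrite /K; field; rewrite !gt_eqF.
suff bound t : (\int[P]_w (f (X t w) - fstar)%:E <=
    ((1 - gamma * mu * b) ^+ t * (f x0 - fstar) + K)%:E)%E.
  by rewrite unlock -addrA; exact: bound.
(* The induction starts at t = 0, where the bound holds with slack K >= 0. *)
elim: t => [|t IH].
  case: sgd => _ _ X0 _ _; under eq_integral do rewrite X0.
  rewrite integral_cst//= probability_setT mule1.
  by rewrite lee_fin expr0 mul1r lerDl.
have := expectation_step f_diff L_ge0 f_smooth f_lb f_PL g_mean g_second
  A_ge0 C_ge0 b_ge0 c_ge0 mu_gt0 gamma_gt0 gamma_le sgd t _ q_le1 IH.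
by move/le_trans; apply; rewrite lee_fin -qK exprS; lra.
Qed.
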